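(* Let $(D,+,-,0,\sigma,\circ,\cdot)$ be a left ditruss. The operation $\cdot$ is left distributive, that is, $a\cdot(b+c)=a\cdot b+a\cdot c$ for all $a,b,c\in D$, if and only if the operation $\circ$ is left skew $\sigma$-distributive, i.e. $a\circ(b+c)=a\circ b-\sigma(a)+a\circ c$ for all $a,b,c\in D$.
   Context: A left ditruss is an algebra $(D,+,-,0,\sigma,\circ,\cdot)$, where $+,\circ,\cdot$ are binary operations, $-$ and $\sigma$ are unary and $0$ is nullary, such that $(D,+,-,0)$ is a (not necessarily abelian) group and $\sigma(a)+a\cdot b=a\circ b$ for all $a,b\in D$. *)

(* Defs.v *)
From HB Require Import structures.
From mathcomp Require Import all_boot ssralg.

Set Implicit Arguments.
Unset Strict Implicit.
Unset Printing Implicit Defensive.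

Local Open Scope ring_scope.

(* The groups of MathComp are either commutative (zmodType) or multiplicative
   and over a choiceType (groupType).  An additive, possibly nonabelian group
   on an arbitrary carrier is obtained here from BaseZmodule, which supplies
   the operations +, 0, - (with their notations) but no axiom. *)
HB.mixin Record BaseZmodule_isAddGroup D of GRing.BaseZmodule D := {
  addgA : @associative D +%R;
  add0g : @left_id D D 0 +%R;
  addg0 : @right_id D D 0 +%R;
  addNg : @left_inverse D D D 0 -%R +%R;
  addgN : @right_inverse D D D 0 -%R +%R
}.

#[short(type="addGroupType")]
HB.structure Definition AddGroup :=
  {D of BaseZmodule_isAddGroup D & GRing.BaseZmodule D}.

Declare Scope ditruss_scope.
Delimit Scope ditruss_scope with ditruss.
Reserved Notation "a ∘ b" (at level 40, left associativity).
Reserved Notation "a ⋅ b" (at level 40, left associativity).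

HB.mixin Record AddGroup_isLeftDitruss D of AddGroup D := {
  sigma : D -> D;
  circ : D -> D -> D;
  dot : D -> D -> D;
  sigmaDdot : forall a b : D, sigma a + dot a b = circ a b
}.

#[short(type="leftDitrussType")]
HB.structure Definition LeftDitruss :=
  {D of AddGroup_isLeftDitruss D & AddGroup D}.

Notation "a ∘ b" := (circ a b) : ditruss_scope.
Notation "a ⋅ b" := (dot a b) : ditruss_scope.

(* Main.v *)
Require Import Defs.
From mathcomp Require Import all_boot ssralg.
Local Open Scope ring_scope.
Local Open Scope ditruss_scope.

(** The translation by [sigma a] carries [a ⋅ _] to [a ∘ _]. By [circB_sigmaD]
    it also carries the right-hand side of left distributivity to the
    right-hand side of left skew [sigma]-distributivity; since translations of
    a group are injective ([addgI]), the two laws are equivalent, instance by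
    instance. *)

Lemma addgI (G : addGroupType) (x : G) : injective (fun y => x + y).
Proof. by move=> y z /(congr1 (fun t => - x + t)); rewrite !addgA addNg !add0g. Qed.

(** The middle term [- sigma a] absorbs the [sigma a] hidden in [a ∘ c], so only
    the leftmost [sigma a] survives. *)
Lemma circB_sigmaD (D : leftDitrussType) (a b c : D) :
  a ∘ b - sigma a + a ∘ c = sigma a + (a ⋅ b + a ⋅ c).
Proof. by rewrite -!sigmaDdot -addgA (addgA (- sigma a)) addNg add0g addgA. Qed.

Theorem theorem3p4 (D : leftDitrussType) :
  (forall a b c : D, a ⋅ (b + c) = a ⋅ b + a ⋅ c) <->
  (forall a b c : D, a ∘ (b + c) = a ∘ b - sigma a + a ∘ c).
Proof.
split=> distr a b c; first by rewrite circB_sigmaD -distr sigmaDdot.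
by apply: (@addgI _ (sigma a)); rewrite sigmaDdot distr circB_sigmaD.
Qed.
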